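(* Let $(X_n,d_n,\{p_n^k\}_{k\in\mathbb{N}})$, $n\in\mathbb{N}$, be a sequence of sequenced Lorentzian metric spaces GH-convergent to a sequenced Lorentzian metric space $(X,d,\{p^k\}_{k\in\mathbb{N}})$. If all the $(X_n,d_n)$ are Lorentzian prelength spaces, then $(X,d)$ is a Lorentzian prelength space. If all the $(X_n,d_n)$ are Lorentzian length spaces, then $(X,d)$ is a Lorentzian length space.
   Context: Let $X$ be a set and $d:X\times X\to[0,+\infty)$ a function. Notation: $x\ll y$ iff $d(x,y)>0$; $I^+(x)=\{y: x\ll y\}$, $I^-(x)=\{y: y\ll x\}$; for $A\subset X$, $I^\pm(A)=\bigcup_{p\in A}I^\pm(p)$ and $I(A)=I^+(A)\cap I^-(A)$; $I(p^1,\dots,p^m):=I(\{p^1,\dots,p^m\})$. For $\epsilon>0$, $I_\epsilon=\{(x,y): d(x,y)\ge\epsilon\}$ and $I_\epsilon(p^1,\dots,p^m)=\{x: \exists i,j\in\{1,\dots,m\},\ d(p^i,x)\ge\epsilon,\ d(x,p^j)\ge\epsilon\}$. $(X,d)$ is a Lorentzian metric space if: (i) $d(x,z)\ge d(x,y)+d(y,z)$ whenever $d(x,y)>0$ and $d(y,z)>0$; (ii) there is a topology $T$ on $X$ such that $d$ is continuous in the product topology and, for every $x,y\in X$ and $\epsilon>0$, the set $I_\epsilon\cap(\overline{I(x,y)}\times\overline{I(x,y)})$ is compact; (iii) for all $x\ne y$ there is $z\in X$ with $d(x,z)\ne d(y,z)$ or $d(z,x)\ne d(z,y)$. A sequenced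 Lorentzian metric space $(X,d,\{p^k\}_{k\in\mathbb{N}})$ is a Lorentzian metric space with a sequence such that $I(\{p^k: k\in\mathbb{N}\})=X$. In this case the topology in (ii) is unique and $X$ is endowed with it. Causal relation: $x\le y$ means $d(p,y)\ge d(p,x)$ and $d(x,p)\ge d(y,p)$ for all $p\in X$; $x<y$ means $x\le y$ and $x\ne y$. A continuous curve $\sigma:[a,b]\to X$ is isocausal if $a\le s<t\le b$ implies $\sigma(s)<\sigma(t)$; it is maximal if it is isocausal and $d(\sigma(t),\sigma(t'))+d(\sigma(t'),\sigma(t''))=d(\sigma(t),\sigma(t''))$ for all $a\le t<t'<t''\le b$. A Lorentzian metric space is a Lorentzian prelength space if for every $x\ll y$ there is an isocausal curve connecting $x$ to $y$, and a Lorentzian length space if for every $x\ll y$ there is a maximal (isocausal) curve connecting $x$ to $y$. For a sequenced space, $X^m:=\overline{I(p^1,\dots,p^m)}\cup\{p^1,\dots,p^m\}$. For a relation $R\subset X\times X'$ between spaces with distances $d,d'$, $R_1\subset X$, $R_2\subset X'$ denote its projections, and $\mathrm{dis}\,R=\sup_{(x,x'),(y,y')\in R}|d(x,y)-d'(x',y')|$. For $m\in\mathbb{N}$, $\epsilon>0$, an $(m,\epsilon)$ $X$–$X'$ quasi-correspondence between $(X,d,\{p^k\})$ and $(X',d',\{p'^k\})$ is a compact set $R\subset X^m\times X'^m$ with $I_\epsilon(p^1,\dots,p^m)\subset R_1$, $I_\epsilon(p'^1,\dots,p'^m)\subset R_2$, $\mathrm{dis}\,R<\epsilon$, and $(p^r,p'^r)\in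 R$ for $r=1,\dots,m$. $(X_n,d_n,\{p_n^k\}_k)$ GH-converges to $(X,d,\{p^k\}_k)$ if for every $m\in\mathbb{N}$ and $\delta>0$ there is $n_0$ such that for every $n\ge n_0$ there exists an $(m,\delta)$ $X_n$–$X$ quasi-correspondence. *)

(* Defs.v *)
From HB Require Import structures.
From mathcomp Require Import all_boot all_order all_algebra.
From mathcomp Require Import all_classical all_reals all_analysis.

Set Implicit Arguments.
Unset Strict Implicit.
Unset Printing Implicit Defensive.

Import Order.TTheory GRing.Theory Num.Theory.
Import numFieldNormedType.Exports.

Local Open Scope classical_set_scope.
Local Open Scope ring_scope.

Section LorentzianSpaces.
Context {R : realType}.

Section OneSpace.
Context {X : topologicalType}.
Variable d : X -> X -> R.

Definition chron (x y : X) : Prop := 0 < d x y.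

Definition Iplus (A : set X) : set X := [set y | exists2 x, A x & chron x y].
Definition Iminus (A : set X) : set X := [set y | exists2 x, A x & chron y x].
Definition Idiam (A : set X) : set X := Iplus A `&` Iminus A.

Definition Ieps (eps : R) : set (X * X) := [set u | eps <= d u.1 u.2].

Definition Idiam_eps (eps : R) (A : set X) : set X :=
  [set x | exists p q, [/\ A p, A q, eps <= d p x & eps <= d x q]].

(* The topology whose existence is required of a Lorentzian metric space is
   the one carried by [X]. It is unique as soon as the space is sequenced,
   which is the only case considered below. *)
Record lorentzian_metric_space : Prop := LorentzianMetricSpace {
  lms_ge0 : forall x y, 0 <= d x y ;
  lms_reverse_triangle : forall x y z,
    0 < d x y -> 0 < d y z -> d x y + d y z <= d x z ;
  lms_continuous : continuous (fun u : X * X => d u.1 u.2) ;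
  lms_compact : forall (x y : X) (eps : R), 0 < eps ->
    compact (Ieps eps `&`
      (closure (Idiam [set x; y]) `*` closure (Idiam [set x; y]))) ;
  lms_distinguishing : forall x y, x <> y ->
    exists z, d x z <> d y z \/ d z x <> d z y
}.

(* Sequences are indexed from 0: [p k] stands for $p^{k+1}$. *)
Definition sequenced_lorentzian_metric_space (p : nat -> X) : Prop :=
  lorentzian_metric_space /\ Idiam (range p) = setT.

Definition causal (x y : X) : Prop :=
  forall p, d p x <= d p y /\ d y p <= d x p.

Definition strict_causal (x y : X) : Prop := causal x y /\ x <> y.

(* Curves on [a, b] are total functions on [R] of which only the restriction
   to [a, b] is used. *)
Definition isocausal_curve (a b : R) (sigma : R -> X) : Prop :=
  [/\ a < b,
      {within `[a, b], continuous sigma} &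
      forall s t, a <= s -> s < t -> t <= b ->
        strict_causal (sigma s) (sigma t)].

Definition maximal_curve (a b : R) (sigma : R -> X) : Prop :=
  isocausal_curve a b sigma /\
  forall t t' t'', a <= t -> t < t' -> t' < t'' -> t'' <= b ->
    d (sigma t) (sigma t') + d (sigma t') (sigma t'') =
    d (sigma t) (sigma t'').

Definition lorentzian_prelength_space : Prop :=
  lorentzian_metric_space /\
  forall x y, chron x y -> exists (a b : R) (sigma : R -> X),
    [/\ isocausal_curve a b sigma, sigma a = x & sigma b = y].

Definition lorentzian_length_space : Prop :=
  lorentzian_metric_space /\
  forall x y, chron x y -> exists (a b : R) (sigma : R -> X),
    [/\ maximal_curve a b sigma, sigma a = x & sigma b = y].

(* $\{p^1, \dots, p^m\}$ *)
Definition first_points (p : nat -> X) (m : nat) : set X := p @` `I_m.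

(* $X^m$ *)
Definition truncation (p : nat -> X) (m : nat) : set X :=
  closure (Idiam (first_points p m)) `|` first_points p m.

End OneSpace.

(* Valued in the extended reals, since the real-valued [sup] is 0 on unbounded
   sets. *)
Definition distortion {X X' : topologicalType} (d : X -> X -> R)
    (d' : X' -> X' -> R) (S : set (X * X')) : \bar R :=
  ereal_sup [set `|d u.1.1 u.2.1 - d' u.1.2 u.2.2|%:E | u in S `*` S].

Record quasi_correspondence {X X' : topologicalType}
    (d : X -> X -> R) (p : nat -> X) (d' : X' -> X' -> R) (p' : nat -> X')
    (m : nat) (eps : R) (S : set (X * X')) : Prop := QuasiCorrespondence {
  qc_sub : S `<=` truncation d p m `*` truncation d' p' m ;
  qc_compact : compact S ;
  qc_fst : Idiam_eps d eps (first_points p m) `<=` fst @` S ;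
  qc_snd : Idiam_eps d' eps (first_points p' m) `<=` snd @` S ;
  qc_distortion : (distortion d d' S < eps%:E)%E ;
  qc_points : forall r, (r < m)%N -> S (p r, p' r)
}.

Definition GH_converges (X_ : nat -> topologicalType)
    (d_ : forall n, X_ n -> X_ n -> R) (p_ : forall n, nat -> X_ n)
    (X : topologicalType) (d : X -> X -> R) (p : nat -> X) : Prop :=
  forall (m : nat) (delta : R), (0 < m)%N -> 0 < delta ->
    exists n0 : nat, forall n, (n0 <= n)%N ->
      exists S : set (X_ n * X),
        quasi_correspondence (d_ n) (p_ n) d p m delta S.

End LorentzianSpaces.

(* Main.v *)
(* Fix x << y in X and pick p^i << x, y << p^j. Some compact diamond K between
   p^i and p^j contains every point needed. As K is compact and X is exhausted
   by compact sets, countably many points q_j suffice to distinguish the points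
   of K, so tau = sum_j 2^-(j+1) (phi(d(q_j, .)) - phi(d(., q_j))), with
   phi(t) = t/(1+t), is a continuous function that is strictly increasing along
   the causal relation of K.

   Lift x, y and finitely many q_j to X_n along a quasi-correspondence, take a
   causal curve in X_n between the lifted endpoints and transport its points
   back to K. By the intermediate value theorem applied to a partial sum of tau
   on X_n, each s in [tau x, tau y] is the approximate time of some transported
   point g_k(s), and these points are causally ordered up to an error. The limit
   g of the g_k along an ultrafilter satisfies tau(g(s)) = s and takes pairwise
   causally related values; hence g is strictly causal, and it is continuous
   because K is compact and tau is injective on causal chains. Additivity of d
   along maximal curves passes to the limit as well. *)
Require Import Defs.
From HB Require Import structures.
From mathcomp Require Import all_boot all_order all_algebra.
From mathcomp Require Import all_classical all_reals all_analysis.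
From mathcomp Require Import ring lra.

Set Implicit Arguments.
Unset Strict Implicit.
Unset Printing Implicit Defensive.

Import Order.TTheory GRing.Theory Num.Theory.
Import numFieldNormedType.Exports.

Local Open Scope classical_set_scope.
Local Open Scope ring_scope.

(** * A bounded reparametrization of distances *)

Section Squash.
Context {R : realType}.
Implicit Types t u : R.

(** Equals t/(1+t), which is bounded, strictly increasing and 1-Lipschitz for t >= 0. *)
Definition squash t : R := 1 - (1 + t)^-1.

Lemma squash_itv t : 0 <= t -> 0 <= squash t <= 1.
Proof.
move=> t0; rewrite /squash subr_ge0 invf_le1 ?lerDl ?ltr_wpDr// t0/=.
by rewrite lerBlDr lerDl invr_ge0 addr_ge0.
Qed.

Lemma squash_lt t u : 0 <= t -> t < u -> squash t < squash u.
Proof.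
move=> t0 tu; rewrite /squash ltrD2l ltrN2 ltf_pV2 ?posrE; lra.
Qed.

Lemma squash_le t u : 0 <= t -> t <= u -> squash t <= squash u.
Proof.
move=> t0; rewrite le_eqVlt => /predU1P[->//|tu].
exact/ltW/squash_lt.
Qed.

Lemma squash_lipschitz t u : 0 <= t -> 0 <= u ->
  `|squash t - squash u| <= `|t - u|.
Proof.
move=> t0 u0; have -> : squash t - squash u = (t - u) * ((1 + t) * (1 + u))^-1.
  by rewrite /squash; field; apply/andP; split; apply: lt0r_neq0; lra.
rewrite normrM ler_piMr// ger0_norm; last by rewrite invr_ge0 mulr_ge0; lra.
by rewrite invf_le1 ?mulr_gt0; nra.
Qed.

Lemma squash_continuous t : 0 <= t -> {for t, continuous squash}.
Proof.
move=> t0; apply: cvgB; first exact: cvg_cst.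
by apply: cvgV; [lra | apply: cvgD; [exact: cvg_cst | exact: cvg_id]].
Qed.

Lemma exprn_half_small (e : R) : 0 < e -> \forall N \near \oo, 2^-1 ^+ N < e.
Proof.
move=> e0; have /cvgr0Pnorm_lt/(_ _ e0) : (fun N => 2^-1 ^+ N) @ \oo --> (0 : R).
  by apply: cvg_expr; rewrite ger0_norm; lra.
by apply: filterS => N; apply: le_lt_trans; exact: ler_norm.
Qed.

Lemma invS_near (e : R) : 0 < e -> \forall k \near \oo, k.+1%:R^-1 < e.
Proof. by move=> e0; exact: (near_infty_natSinv_lt (PosNum e0)). Qed.

End Squash.

(** * Time functions built from countably many test points *)

Section TimeFunction.
Context {R : realType} {X : topologicalType}.
Context (d : X -> X -> R).
Implicit Types (q : nat -> X) (z : X) (N : nat).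

(** As [z] moves up the causal relation, [d a z] grows and [d z a] shrinks, so the difference is
    monotone. *)
Definition test (a z : X) : R := squash (d a z) - squash (d z a).

Definition tsum q N z : R := \sum_(j < N) 2^-1 ^+ j.+1 * test (q j) z.

Definition time q z : R := limn (fun N => tsum q N z).

Context (d_ge0 : forall x y, 0 <= d x y).

Lemma test_bound a z : `|test a z| <= 1.
Proof.
have /andP[? ?] := squash_itv (d_ge0 a z).
have /andP[? ?] := squash_itv (d_ge0 z a).
by rewrite /test ler_norml; lra.
Qed.

Lemma test_causal a z z' : causal d z z' -> test a z <= test a z'.
Proof. by move=> /(_ a)[? ?]; apply: lerB; exact: squash_le. Qed.

(** The geometric tail is kept as a difference of powers, so that the induction on [k]
    telescopes. *)
Lemma tsum_tail q N k z :
  `|tsum q (N + k) z - tsum q N z| <= 2^-1 ^+ N - 2^-1 ^+ (N + k).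
Proof.
elim: k => [|k IH]; first by rewrite addn0 !subrr normr0.
rewrite addnS /tsum big_ord_recr/= addrAC.
apply: (le_trans (ler_normD _ _)).
rewrite normrM ger0_norm ?exprn_ge0//.
have := test_bound (q (N + k)%N) z; have := exprn_ge0 (N + k) (_ : 0 <= 2^-1 :> R).
rewrite invr_ge0 ler0n => /(_ isT); move: IH; rewrite /tsum exprS; nra.
Qed.

Lemma is_cvg_tsum q z : cvgn (fun N => tsum q N z).
Proof.
apply/cauchy_cvgP/cauchy_exP => e e0.
have [N _ smallN] := exprn_half_small e0.
exists (tsum q N z); exists N => // M NM; rewrite /ball/= distrC.
rewrite -(subnKC NM); apply: le_lt_trans (tsum_tail _ _ _ _) _.
apply: le_lt_trans (smallN N (leqnn N)); rewrite gerBl exprn_ge0//; lra.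
Qed.

Lemma time_approx q N z : `|time q z - tsum q N z| <= 2^-1 ^+ N.
Proof.
have cvgd : (fun M => `|tsum q M z - tsum q N z|) @ \oo -->
    `|time q z - tsum q N z|.
  apply: cvg_norm; apply: cvgB; last exact: cvg_cst.
  exact: is_cvg_tsum.
rewrite -(cvg_lim _ cvgd)//; apply: limr_le; first by apply/cvg_ex; eexists; exact: cvgd.
exists N => // M /= NM; rewrite -(subnKC NM).
apply: le_trans (tsum_tail _ _ _ _) _; rewrite gerBl exprn_ge0//; lra.
Qed.

(** Strict inequalities between partial sums may be lost in the limit; a gap [c] uniform in [N]
    survives. *)
Lemma time_gap q (c : R) n0 z z' :
  (forall N, (n0 <= N)%N -> c <= tsum q N z' - tsum q N z) ->
  c <= time q z' - time q z.
Proof.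
move=> gap; apply/ler_addgt0Pr => e e0.
have [n1 _ small] := exprn_half_small (ltac:(lra) : 0 < e / 2).
have {small} := small (maxn n0 n1) (leq_maxr _ _).
have {gap} := gap _ (leq_maxl n0 n1).
have := time_approx q (maxn n0 n1) z; have := time_approx q (maxn n0 n1) z'.
rewrite !ler_norml; lra.
Qed.

Lemma tsum_causal q N z z' : causal d z z' -> tsum q N z <= tsum q N z'.
Proof.
move=> zz'; apply: ler_sum => j _; apply: ler_wpM2l; first by rewrite exprn_ge0//; lra.
exact: test_causal.
Qed.

Lemma time_causal q z z' : causal d z z' -> time q z <= time q z'.
Proof.
move=> zz'; rewrite -subr_ge0; apply: (@time_gap _ _ 0) => N _.
by rewrite subr_ge0 tsum_causal.
Qed.

Definition separates q (K : set X) := forall z z', K z -> K z' -> z <> z' ->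
  exists j, d (q j) z <> d (q j) z' \/ d z (q j) <> d z' (q j).

Lemma time_strict_causal q K z z' : separates q K -> K z -> K z' ->
  strict_causal d z z' -> time q z < time q z'.
Proof.
move=> sepK Kz Kz' [zz' neq]; have [j sepj] := sepK _ _ Kz Kz' neq.
(* The term of index [j] contributes exactly [c] and all others are monotone, so every partial sum
   that includes it has a gap of at least [c]. *)
set c := 2^-1 ^+ j.+1 * (test (q j) z' - test (q j) z).
have c0 : 0 < c.
  apply: mulr_gt0; first by rewrite exprn_gt0//; lra.
  have [le1 le2] := zz' (q j); rewrite subr_gt0 /test.
  have s1 := squash_le (d_ge0 (q j) z) le1.
  have s2 := squash_le (d_ge0 z' (q j)) le2.
  case: sepj => /eqP.
    move=> ne1; have : squash (d (q j) z) < squash (d (q j) z').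
      by apply: squash_lt => //; rewrite lt_neqAle ne1.
    lra.
  rewrite eq_sym => ne2; have : squash (d z' (q j)) < squash (d z (q j)).
    by apply: squash_lt => //; rewrite lt_neqAle ne2.
  lra.
rewrite -subr_gt0; apply: lt_le_trans c0 _.
apply: (@time_gap _ _ j.+1) => N jN.
rewrite /tsum (bigD1 (Ordinal jN))//= [X in _ <= _ - X](bigD1 (Ordinal jN))//= /c.
rewrite mulrBr opprD addrACA lerDl subr_ge0; apply: ler_sum => i _.
by apply: ler_wpM2l; [rewrite exprn_ge0//; lra | exact: test_causal].
Qed.

Context (d_continuous : continuous (fun u : X * X => d u.1 u.2)).

Lemma continuous_dr a : continuous (d a).
Proof.
move=> z; apply: (@continuous2_cvg _ _ _ _ _ _ (fun=> a) id d a z).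
- exact: (@d_continuous (a, z)).
- exact: cvg_cst.
- exact: cvg_id.
Qed.

Lemma continuous_dl a : continuous (d^~ a).
Proof.
move=> z; apply: (@continuous2_cvg _ _ _ _ _ _ id (fun=> a) d z a).
- exact: (@d_continuous (z, a)).
- exact: cvg_id.
- exact: cvg_cst.
Qed.

Lemma continuous_tsum q N : continuous (tsum q N).
Proof.
move=> z; elim: N => [|N IH].
  by under [X in continuous_at _ X]eq_fun do rewrite /tsum big_ord0; exact: cvg_cst.
under [X in continuous_at _ X]eq_fun do rewrite /tsum big_ord_recr/=.
apply: cvgD; first exact: IH.
apply: cvgM; first exact: cvg_cst.
apply: cvgB; apply: continuous_comp; do ?exact: squash_continuous.
- exact: continuous_dr.
- exact: continuous_dl.
Qed.

Lemma continuous_time q : continuous (time q).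
Proof.
move=> z; apply/cvgrPdist_lt => e e0.
have [N _ small] := exprn_half_small (ltac:(lra) : 0 < e / 3).
have {small} smallN := small N (leqnn N).
have e3 : 0 < e / 3 by lra.
have /cvgrPdist_lt/(_ _ e3) := @continuous_tsum q N z.
apply: filterS => z'; have := time_approx q N z; have := time_approx q N z'.
by move: smallN; rewrite /= !ler_norml !ltr_norml; lra.
Qed.

End TimeFunction.

(** * Compact slabs and countable separation in a Lorentzian metric space *)

Section LorentzianMetricSpace.
Context {R : realType} {X : topologicalType} (d : X -> X -> R).
Context (dX : lorentzian_metric_space d).
Implicit Types x y z a b : X.

Let d_ge0 := lms_ge0 dX.
Let d_cont := lms_continuous dX.

Lemma d_refl0 x : d x x = 0.
Proof.
apply/eqP; rewrite eq_le d_ge0 andbT leNgt; apply/negP => dxx.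
by have := lms_reverse_triangle dX dxx dxx; lra.
Qed.

Lemma chron_trans x y z : chron d x y -> chron d y z -> chron d x z.
Proof. by rewrite /chron => xy yz; have := lms_reverse_triangle dX xy yz; lra. Qed.

Lemma chron_causal x y : chron d x y -> causal d x y.
Proof.
move=> xy a; split.
- have := d_ge0 a x; rewrite le_eqVlt => /predU1P[<-//|ax].
  by have := lms_reverse_triangle dX ax xy; move: xy; rewrite /chron; lra.
- have := d_ge0 y a; rewrite le_eqVlt => /predU1P[<-//|ya].
  by have := lms_reverse_triangle dX xy ya; move: xy; rewrite /chron; lra.
Qed.

Lemma chron_strict_causal x y : chron d x y -> strict_causal d x y.
Proof.
move=> xy; split; first exact: chron_causal.
by move=> E; move: xy; rewrite /chron E d_refl0 ltxx.
Qed.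

(** By the distinguishing axiom the distances from and to all points determine a point, so its
    singleton is an intersection of closed level sets. *)
Lemma closed_point a : closed [set a].
Proof.
have -> : [set a] = \bigcap_(z in setT)
    (d z @^-1` [set d z a] `&` (d^~ z) @^-1` [set d a z]).
  apply/seteqP; split => [x -> z _ //|x xa].
  apply: contrapT => /(lms_distinguishing dX)[z].
  by have /= [-> ->] := xa z I; case.
apply: closed_bigI => z _; apply: closedI; apply: preimage_closed.
- by move=> *; exact: continuous_dr.
- exact: closed_eq.
- by move=> *; exact: continuous_dl.
- exact: closed_eq.
Qed.

Definition slab a b (e : R) : set X := [set z | e <= d a z /\ e <= d z b].

(** The compactness axiom concerns pairs: slice at first coordinate [a], project to the second, and
    cut by the closed condition at [b]. The outer points [a'] and [b'] place [a] and the whole slab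
    in one diamond. *)
Lemma compact_slab a a' b b' (e : R) : 0 < e -> chron d a' a -> chron d b b' ->
  compact (slab a b e).
Proof.
move=> e0 a'a bb'; set D := closure (Idiam d [set a'; b']).
set S := (Ieps d e `&` (D `*` D)) `&` fst @^-1` [set a].
have cS : compact S.
  apply: compact_closedI; first exact: lms_compact.
  apply: preimage_closed; first by move=> [? ?] _; exact: cvg_fst.
  exact: closed_point.
suff -> : slab a b e = snd @` S `&` (d^~ b) @^-1` [set r | e <= r].
  apply: compact_closedI.
    by apply: continuous_compact cS; apply: continuous_subspaceT => -[? ?]; exact: cvg_snd.
  apply: preimage_closed; first by move=> *; exact: continuous_dl.
  exact: closed_ge.
apply/seteqP; split => [z /= [az zb]|z /=]; last first.
  by move=> [[[u v]/= [[auv _] ua] <-{z}] vb]; split => //; rewrite -ua.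
have a_z : chron d a z by exact: lt_le_trans az.
have z_b : chron d z b by exact: lt_le_trans zb.
split=> //; exists (a, z) => //; split=> //; split=> //; split => /=;
  apply: subset_closure.
- split; [exists a' => //; by left | exists b'; [by right|]].
  exact: chron_trans a_z (chron_trans z_b bb').
- split; [exists a'; [by left|] | exists b'; [by right|]].
  + exact: chron_trans a_z.
  + exact: chron_trans bb'.
Qed.

(* Total boundedness of the compact set [C] for the uniform distance on [K] of
   the functions [d a] and [d^~ a]. *)
Lemma finite_net (C K : set X) (e : R) : compact C -> compact K -> 0 < e ->
  exists l : seq X, forall a, C a -> exists2 f, f \in l &
    forall z, K z -> `|d a z - d f z| < e /\ `|d z a - d z f| < e.
Proof.
move=> /compact_near_coveringP cC /compact_near_coveringP cK e0.
pose close f a := forall z, K z -> `|d a z - d f z| < e /\ `|d z a - d z f| < e.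
(* Tube argument: closeness holds near each pair [(z, f)], and compactness of [K] yields one
   neighbourhood of [f] valid for all [z]. *)
have near_close f : \forall a \near f, close f a.
  apply: cK => z Kz; apply: filterI.
  - have h : (fun u : X * X => d u.2 u.1 - d f u.1) u @[u --> (z, f)] --> (0 : R).
      rewrite -(subrr (d f z)); apply: cvgB.
        by apply: (@continuous2_cvg _ _ _ _ _ _ snd fst d f z);
          [exact: (@d_cont (f, z)) | exact: cvg_snd | exact: cvg_fst].
      apply: continuous_comp; first exact: cvg_fst.
      exact: continuous_dr.
    by have /cvgr0Pnorm_lt := h; exact.
  - have h : (fun u : X * X => d u.1 u.2 - d u.1 f) u @[u --> (z, f)] --> (0 : R).
      rewrite -(subrr (d z f)); apply: cvgB; first exact: (@d_cont (z, f)).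
      apply: (@cvg_comp _ _ _ fst (d^~ f) _ (nbhs z)); first exact: cvg_fst.
      exact: continuous_dl.
    by have /cvgr0Pnorm_lt := h; exact.
(* Properties of all sufficiently large lists, ordered by inclusion. The covering property of [C]
   along this filter extracts finitely many centres. *)
pose F : set_system (seq X) :=
  [set A | exists l : seq X, forall l' : seq X, {subset l <= l'} -> A l'].
have FF : Filter F.
  split.
  - by exists [::].
  - move=> A B [l1 A1] [l2 B2]; exists (l1 ++ l2) => l' sub.
    by split; [apply: A1 | apply: B2] => x xl; apply: sub; rewrite mem_cat xl ?orbT.
  - by move=> A B AB [l Al]; exists l => l' /Al /AB.
have [l cover_l] : F [set l : seq X | C `<=` (fun a => exists2 f, f \in l & close f a)].
  apply: (cC _ F (fun (l : seq X) a => exists2 f, f \in l & close f a)) => f Cf.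
  exists (close f, [set l : seq X | f \in l]) => /=.
    by split; [exact: near_close | exists [:: f] => l'; apply; rewrite mem_head].
  by move=> [a l] /= [fa fl]; exists f.
by exists l; exact: cover_l.
Qed.

Context (p : nat -> X) (p_gen : Idiam d (range p) = setT).

Lemma sequenced_bounds z : exists i j, chron d (p i) z /\ chron d z (p j).
Proof.
have : Idiam d (range p) z by rewrite p_gen.
by move=> [[_ [i _ <-] ?] [_ [j _ <-] ?]]; exists i, j.
Qed.

(** Countably many compact slabs between the generators cover the space. Finite nets of every
    precision in each of them form a countable family, and a point distinguishing two points of [K]
    can be replaced by a close enough net point. *)
Lemma exists_separating (K : set X) : compact K -> exists q, separates d q K.
Proof.
move=> cK.
have [->|/set0P[x0 _]] := eqVneq K set0; first by exists p => z ? [].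
(* The index [(i, j, k, m)] stands for the slab between [p i] and [p j] at level 1/(k+1), with a net
   of precision 1/(m+1). *)
pose good (i : nat * nat * nat * nat) (l : seq X) :=
  forall a, slab (p i.1.1.1) (p i.1.1.2) i.1.2.+1%:R^-1 a ->
  exists2 f, f \in l & forall z, K z ->
    `|d a z - d f z| < i.2.+1%:R^-1 /\ `|d z a - d z f| < i.2.+1%:R^-1.
have /choice[L goodL] i : exists l, good i l.
  have [i' [_ [pi _]]] := sequenced_bounds (p i.1.1.1).
  have [_ [j' [_ pj]]] := sequenced_bounds (p i.1.1.2).
  by apply: finite_net => //; apply: compact_slab pi pj.
(* [q] enumerates the members of all nets; [x0] fills invalid codes and positions beyond the end of
   a list. *)
pose q n := if unpickle n is Some (i, r) then nth x0 (L i) r else x0.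
have net a (e : R) : 0 < e -> exists n, forall z, K z ->
    `|d a z - d (q n) z| < e /\ `|d z a - d z (q n)| < e.
  move=> e0.
  have [i [j [ia aj]]] := sequenced_bounds a.
  have min0 : 0 < Num.min (d (p i) a) (d a (p j)) by rewrite lt_min ia aj.
  have [k _ /(_ k (leqnn k))] := invS_near min0.
  rewrite /= lt_min => /andP[/ltW ki /ltW kj].
  have [m _ /(_ m (leqnn m)) me] := invS_near e0.
  have [f fL close_f] := goodL (i, j, k, m) a (conj ki kj).
  exists (pickle ((i, j, k, m), index f (L (i, j, k, m)))) => z Kz.
  rewrite /q pickleK nth_index//.
  by have [? ?] := close_f z Kz; split; exact: lt_trans me.
exists q => z z' Kz Kz' /(lms_distinguishing dX)[a].
have split_ineq (u v : R) : u <> v -> exists2 e, 0 < e & forall u' v',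
    `|u - u'| < e -> `|v - v'| < e -> u' <> v'.
  move=> /eqP uv; exists (`|u - v| / 2) => [|u' v' h1 h2 E].
    by rewrite divr_gt0// normr_gt0 subr_eq0.
  have := ler_distD u' u v; rewrite {2}E (distrC v' v); lra.
case=> /split_ineq[e e0 sep_e]; have [n close_n] := net a e e0;
  have [? ?] := close_n z Kz; have [? ?] := close_n z' Kz'; exists n.
- by right; apply: sep_e.
- by left; apply: sep_e.
Qed.

End LorentzianMetricSpace.

(** * Approximately causal curves *)

Section Curves.
Context {R : realType} {X : topologicalType} (d : X -> X -> R).

(** The test points are restricted to [T] because a quasi-correspondence is only guaranteed to lift
    part of the space. *)
Definition causal_upto (e : R) (T : set X) (z z' : X) : Prop :=
  forall a, T a -> d a z <= d a z' + e /\ d z' a <= d z a + e.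

Definition additive_curve (a b : R) (sigma : R -> X) : Prop :=
  forall t t' t'', a <= t -> t < t' -> t' < t'' -> t'' <= b ->
    d (sigma t) (sigma t') + d (sigma t') (sigma t'') =
    d (sigma t) (sigma t'').

(* Treats both halves of the theorem at once: [M = False] gives the prelength
   property and [M = True] the length property. *)
Definition curve_connected (M : Prop) : Prop :=
  forall x y, chron d x y -> exists (a b : R) (sigma : R -> X),
    [/\ isocausal_curve d a b sigma, sigma a = x, sigma b = y &
        M -> additive_curve a b sigma].

(* [g s] is a point at approximate time [s] of an approximately causal curve
   from [x] to [y], and [t s] is its parameter on that curve. *)
Record approximant (tau : X -> R) (x y : X) (K T : set X) (e : R) (M : Prop)
    (t : R -> R) (g : R -> X) : Prop := Approximant {
  apx_in : forall s, tau x <= s <= tau y -> K (g s) ;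
  apx_time : forall s, tau x <= s <= tau y -> `|tau (g s) - s| <= e ;
  apx_left : forall s, tau x <= s <= tau y -> causal_upto e T x (g s) ;
  apx_right : forall s, tau x <= s <= tau y -> causal_upto e T (g s) y ;
  apx_causal : forall s s', tau x <= s <= tau y -> tau x <= s' <= tau y ->
    t s <= t s' -> causal_upto e T (g s) (g s') ;
  apx_additive : M -> forall s s' s'', tau x <= s <= tau y ->
    tau x <= s' <= tau y -> tau x <= s'' <= tau y ->
    t s <= t s' -> t s' <= t s'' ->
    `|d (g s) (g s') + d (g s') (g s'') - d (g s) (g s'')| <= e
}.

End Curves.

(** * Transport of curves along a quasi-correspondence *)

Section Transport.
Context {R : realType} {X Y : topologicalType} (d : X -> X -> R).
Context (dY : Y -> Y -> R) (pY : nat -> Y) (p : nat -> X).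
Context (dYL : lorentzian_metric_space dY) (dXL : lorentzian_metric_space d).
Context (m : nat) (del : R) (S : set (Y * X)).
Context (qcS : quasi_correspondence dY pY d p m del S).

Lemma qc_dist u v z w : S (u, z) -> S (v, w) -> `|dY u v - d z w| < del.
Proof.
move=> uz vw; have := qc_distortion qcS; rewrite -lte_fin; apply: le_lt_trans.
by apply: ereal_sup_ubound; exists ((u, z), (v, w)).
Qed.

Lemma test_dist u v z w : S (u, z) -> S (v, w) ->
  `|test dY u v - test d z w| <= 2 * del.
Proof.
move=> uz vw.
have := le_trans (squash_lipschitz (lms_ge0 dYL v u) (lms_ge0 dXL w z))
  (ltW (qc_dist vw uz)).
have := le_trans (squash_lipschitz (lms_ge0 dYL u v) (lms_ge0 dXL z w))
  (ltW (qc_dist uz vw)).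
rewrite /test !ler_norml; lra.
Qed.

(** The weights add up to 1 - 2^-N, so the error [2 * del] of a single test does not accumulate with
    [N]. *)
Lemma tsum_dist (qY : nat -> Y) (q : nat -> X) N c z :
  (forall j, (j < N)%N -> S (qY j, q j)) -> S (c, z) ->
  `|tsum dY qY N c - tsum d q N z| <= 2 * del.
Proof.
move=> Sq cz.
have del0 : 0 <= 2 * del.
  by rewrite mulr_ge0//; exact: ltW (le_lt_trans (normr_ge0 _) (qc_dist cz cz)).
suff : `|tsum dY qY N c - tsum d q N z| <= (1 - 2^-1 ^+ N) * (2 * del).
  move/le_trans; apply; rewrite ler_piMl// gerBl exprn_ge0//; lra.
elim: N Sq => [|N IH] Sq; first by rewrite /tsum !big_ord0 subrr normr0 expr0 subrr mul0r.
rewrite /tsum !big_ord_recr/= opprD addrACA -mulrBr.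
apply: le_trans (ler_normD _ _) _; rewrite normrM.
have w0 : 0 <= 2^-1 ^+ N.+1 :> R by rewrite exprn_ge0//; lra.
rewrite (ger0_norm w0).
have := IH (fun j jN => Sq j (leqW jN)); have := test_dist (Sq N (ltnSn N)) cz.
rewrite /tsum exprS in w0 * => h1 h2.
have := ler_wpM2l w0 h1; move: h2; lra.
Qed.

Context (M : Prop) (connY : curve_connected dY M).

(** Going to [Y] and back costs less than [2 * del], so the margin [3 * e0] leaves at least [e0] for
    the transported points. Causality costs [2 * del] and additivity, which involves three
    distances, [3 * del]. Time is off by at most [eta / 2] from truncation and distortion, and by
    [eta / 2] more from the choice of the parameter. *)
Lemma transport_curve (q : nat -> X) (N : nat) (T : set X) (x y : X)
    (i j : nat) (e0 eta : R) :
  chron d x y -> (i < m)%N -> (j < m)%N -> 0 < e0 ->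
  3 * e0 <= d (p i) x -> 3 * e0 <= d y (p j) -> del <= e0 -> del <= d x y ->
  T `<=` Idiam_eps d del (first_points p m) ->
  (forall k, (k < N)%N -> Idiam_eps d del (first_points p m) (q k)) ->
  3 * del <= eta -> 2^-1 ^+ N + 2 * del <= eta / 2 ->
  exists t g,
    approximant d (time d q) x y (slab d (p i) (p j) e0) T eta M t g.
Proof.
move=> xy im jm e0_gt0 pix ypj del_e0 del_xy T_sub q_in del_eta N_eta.
have Pi : first_points p m (p i) by exists i.
have Pj : first_points p m (p j) by exists j.
have ix0 : 0 < d (p i) x by lra.
have yj0 : 0 < d y (p j) by lra.
have ixy := lms_reverse_triangle dXL ix0 xy.
have xyj := lms_reverse_triangle dXL xy yj0.
have xy0 : 0 < d x y := xy.
have [[x1 x'] Sx' /= Ex] : (snd @` S) x.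
  by apply: (qc_snd qcS); exists (p i), (p j); split => //; lra.
have [[y1 y'] Sy' /= Ey] : (snd @` S) y.
  by apply: (qc_snd qcS); exists (p i), (p j); split => //; lra.
subst x' y'.
have [a [b [sg [[ab csg iso] sga sgb addM]]]] : exists (a b : R) (sigma : R -> Y),
    [/\ isocausal_curve dY a b sigma, sigma a = x1, sigma b = y1 &
        M -> additive_curve dY a b sigma].
  apply: connY; have := qc_dist Sx' Sy'; rewrite /chron ltr_norml; lra.
have sg_le t t' : a <= t -> t <= t' -> t' <= b -> causal dY (sg t) (sg t').
  move=> at_; rewrite le_eqVlt => /predU1P[->//|tt'] t'b.
  by have [] := iso t t' at_ tt' t'b.
(* Since [x1] precedes [sg t] and [sg t] precedes [y1], the distances from [pY i] and to [pY j] stay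
   above [3 * e0 - del], hence above [del], and [sg t] has a partner. *)
have /choice[z Sz] t : exists z, a <= t <= b -> S (sg t, z).
  case: (boolP (a <= t <= b)) => [/andP[at_ tb]|]; last by exists x.
  have [[c z] Sz /= Ec] : (fst @` S) (sg t).
    apply: (qc_fst qcS); exists (pY i), (pY j).
    have Si := qc_points qcS im; have Sj := qc_points qcS jm.
    have [] := sg_le a t (lexx a) at_ tb (pY i); rewrite sga => h1 _.
    have [_] := sg_le t b at_ tb (lexx b) (pY j); rewrite sgb => h2.
    have := qc_dist Si Sx'; have := qc_dist Sy' Sj; rewrite !ltr_norml => ? ?.
    by split; [exists i | exists j | lra | lra].
  by exists z => _; rewrite -Ec.
have /choice[qY SqY] k : exists c, (k < N)%N -> S (c, q k).
  case: (ltnP k N) => [kN|]; last by exists x1.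
  by have [[c w] Sc /= <-] := qc_snd qcS (q_in _ kN); exists c.
(* The transported points [z t] need not depend continuously on [t]; the intermediate value theorem
   is therefore applied on [Y]. *)
pose F t := tsum dY qY N (sg t).
have F_time c w : S (c, w) -> `|time d q w - tsum dY qY N c| <= eta / 2.
  move=> Scw; apply: le_trans N_eta.
  have := time_approx (lms_ge0 dXL) q N w; have := tsum_dist SqY Scw.
  rewrite !ler_norml; lra.
have cF : {within `[a, b], continuous F}.
  move=> t; apply: continuous_comp; first exact: csg.
  exact: (continuous_tsum (lms_ge0 dYL) (lms_continuous dYL)).
have /choice[t ts] s : exists t, time d q x <= s <= time d q y ->
    a <= t <= b /\ `|time d q (z t) - s| <= eta.
  case: (boolP (time d q x <= s <= time d q y)) => [/andP[xs sy]|]; last by exists a.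
  suff [t tab Fts] : exists2 t, a <= t <= b & `|F t - s| <= eta / 2.
    exists t => _; split=> //; move: Fts; have := F_time _ _ (Sz _ tab).
    by rewrite /F !ler_norml; lra.
  have := F_time _ _ Sx'; have := F_time _ _ Sy'; rewrite -sga -sgb -!/(F _) => hb ha.
  (* [F a] and [F b] match the times of [x] and [y] only up to [eta / 2], so [s] may fall outside
     their range; an endpoint then serves as witness. *)
  have [sFa|Fas] := ltP s (F a).
    by exists a; [rewrite lexx ltW | move: ha; rewrite !ler_norml; lra].
  have [sFb|Fbs] := ltP (F b) s.
    by exists b; [rewrite lexx ltW | move: hb; rewrite !ler_norml; lra].
  have [|t tab Ft] := IVT (ltW ab) cF (v := s).
    by rewrite ge_min Fas le_max Fbs orbT.
  exists t; first by move: tab; rewrite in_itv.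
  by rewrite Ft subrr normr0; move: ha; rewrite ler_norml; lra.
have approx_causal c c' w w' : S (c, w) -> S (c', w') -> causal dY c c' ->
    causal_upto d eta T w w'.
  move=> Scw Scw' cc' v Tv; have [[u v'] Su /= Ev] := qc_snd qcS (T_sub _ Tv).
  subst v'; have [? ?] := cc' u.
  have := qc_dist Su Scw; have := qc_dist Su Scw'.
  have := qc_dist Scw Su; have := qc_dist Scw' Su.
  by rewrite !ltr_norml; lra.
exists t, (z \o t); split=> /=.
- move=> s /ts[tab _]; have Stz := Sz _ tab; move: tab => /andP[at_ tb].
  have Si := qc_points qcS im; have Sj := qc_points qcS jm.
  have [] := sg_le a (t s) (lexx a) at_ tb (pY i); rewrite sga => h1 _.
  have [_] := sg_le (t s) b at_ tb (lexx b) (pY j); rewrite sgb => h2.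
  have := qc_dist Si Sx'; have := qc_dist Sy' Sj.
  have := qc_dist Si Stz; have := qc_dist Stz Sj.
  by rewrite !ltr_norml => ? ? ? ?; split; lra.
- by move=> s /ts[].
- move=> s /ts[tab _]; have Stz := Sz _ tab; move: tab => /andP[at_ tb].
  by apply: approx_causal Sx' Stz _; rewrite -sga; apply: sg_le.
- move=> s /ts[tab _]; have Stz := Sz _ tab; move: tab => /andP[at_ tb].
  by apply: approx_causal Stz Sy' _; rewrite -sgb; apply: sg_le.
- move=> s s' /ts[tab _] /ts[t'ab _] le_t.
  apply: (approx_causal _ _ _ _ (Sz _ tab) (Sz _ t'ab)).
  by apply: sg_le => //; [case/andP: tab | case/andP: t'ab].
- move=> hM s s' s'' /ts[tab _] /ts[t'ab _] /ts[t''ab _] le1 le2.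
  have addsg : dY (sg (t s)) (sg (t s')) + dY (sg (t s')) (sg (t s'')) =
      dY (sg (t s)) (sg (t s'')).
    (* Distinct values of [s] may share a parameter; additivity is then trivial because [dY]
       vanishes on the diagonal. *)
    move: le1 le2; rewrite le_eqVlt => /predU1P[->|lt1].
      by rewrite (d_refl0 dYL) add0r.
    rewrite le_eqVlt => /predU1P[->|lt2]; first by rewrite (d_refl0 dYL) addr0.
    by apply: (addM hM) => //; [case/andP: tab | case/andP: t''ab].
  have := qc_dist (Sz _ tab) (Sz _ t'ab); have := qc_dist (Sz _ t'ab) (Sz _ t''ab).
  have := qc_dist (Sz _ tab) (Sz _ t''ab).
  by rewrite !ltr_norml ler_norml; lra.
Qed.

End Transport.

(** * The limit curve along an ultrafilter *)

Section UltraLimit.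
Context {R : realType} {X : topologicalType} (d : X -> X -> R).
Context (dX : lorentzian_metric_space d).

(** Compactness supplies a cluster point, and an ultrafilter converges to each of its cluster
    points. *)
Lemma compact_ultra_lim (I : Type) (U : set_system I) (K : set X) (u : I -> X) :
  UltraFilter U -> compact K -> (\forall k \near U, K (u k)) ->
  exists2 z, K z & u @ U --> z.
Proof.
move=> UU cK KU; have [z [Kz clz]] := cK (u @ U) _ KU.
exists z => // V Vz; have [//|UV] := in_ultra_setVsetC (u @^-1` V) UU.
by have [w [nVw Vw]] := clz (~` V) V UV Vz.
Qed.

Lemma closed_causal_l w : closed [set z | causal d z w].
Proof.
rewrite (_ : [set z | _] = \bigcap_(a in setT)
    (d a @^-1` [set r | r <= d a w] `&` (d^~ a) @^-1` [set r | d w a <= r])).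
  apply: closed_bigI => a _; apply: closedI; apply: preimage_closed.
  - by move=> *; exact: (continuous_dr (lms_continuous dX)).
  - exact: closed_le.
  - by move=> *; exact: (continuous_dl (lms_continuous dX)).
  - exact: closed_ge.
by apply/seteqP; split => [z zw a _|z zw a]; [exact: zw | exact: (zw a I)].
Qed.

Lemma closed_causal_r w : closed [set z | causal d w z].
Proof.
rewrite (_ : [set z | _] = \bigcap_(a in setT)
    (d a @^-1` [set r | d a w <= r] `&` (d^~ a) @^-1` [set r | r <= d w a])).
  apply: closed_bigI => a _; apply: closedI; apply: preimage_closed.
  - by move=> *; exact: (continuous_dr (lms_continuous dX)).
  - exact: closed_ge.
  - by move=> *; exact: (continuous_dl (lms_continuous dX)).
  - exact: closed_le.
by apply/seteqP; split => [z zw a _|z zw a]; [exact: zw | exact: (zw a I)].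
Qed.

Context (K : set X) (tau : X -> R) (x y : X) (M : Prop).
Context (cK : compact K) (tau_cont : continuous tau).
Context (tau_mono : forall z z', causal d z z' -> tau z <= tau z').
Context (tau_strict : forall z z', K z -> K z' -> strict_causal d z z' ->
  tau z < tau z').
Context (Kx : K x) (Ky : K y) (xy : strict_causal d x y).
Context (e_ : nat -> R) (T_ : nat -> set X).
Context (e_cvg : e_ k @[k --> \oo] --> (0 : R)).
Context (T_near : forall a, \forall k \near \oo, T_ k a).
Context (t_ : nat -> R -> R) (g_ : nat -> R -> X).
Context (apx : forall k,
  approximant d tau x y K (T_ k) (e_ k) M (t_ k) (g_ k)).

Lemma limit_curve : exists (a b : R) (sigma : R -> X),
  [/\ isocausal_curve d a b sigma, sigma a = x, sigma b = y &
      M -> additive_curve d a b sigma].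
Proof.
(* A single ultrafilter gives limits for all uncountably many [s] at once and decides how the
   parameters [t_ k s] and [t_ k s'] are ordered. *)
have [U [UU sU]] := ultraFilterLemma (eventually_filter : ProperFilter \oo).
have eU : e_ k @[k --> U] --> (0 : R) by move=> A /e_cvg /sU.
have TU a : \forall k \near U, T_ k a by apply: sU; exact: T_near.
set A := tau x; set B := tau y.
have AB : A < B by exact: tau_strict.
have comp_lim (f : X -> R) (u : nat -> X) z : continuous f -> u @ U --> z ->
    f (u k) @[k --> U] --> f z.
  by move=> cf uz; exact: cvg_comp uz (@cf z).
have dr a := continuous_dr (lms_continuous dX) (a := a).
have dl a := continuous_dl (lms_continuous dX) (a := a).
have causal_lim (u v : nat -> X) z z' : u @ U --> z -> v @ U --> z' ->
    (\forall k \near U, causal_upto d (e_ k) (T_ k) (u k) (v k)) -> causal d z z'.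
  move=> uz vz' uv a; split.
  - rewrite -[leRHS]addr0; apply: (ler_cvg_to (a := U)
      (f := fun k => d a (u k)) (g := fun k => d a (v k) + e_ k)).
    + exact: comp_lim (dr a) uz.
    + by apply: cvgD eU; exact: comp_lim (dr a) vz'.
    + by near=> k; have [] := near uv k _ a (near (TU a) k _).
  - rewrite -[leRHS]addr0; apply: (ler_cvg_to (a := U)
      (f := fun k => d (v k) a) (g := fun k => d (u k) a + e_ k)).
    + exact: comp_lim (dl a) vz'.
    + by apply: cvgD eU; exact: comp_lim (dl a) uz.
    + by near=> k; have [] := near uv k _ a (near (TU a) k _).
have /choice[sg sgP] s : exists z, A <= s <= B -> K z /\ (g_ k s @[k --> U] --> z).
  case: (boolP (A <= s <= B)) => [sAB|]; last by exists x.
  have [z Kz zl] : exists2 z, K z & g_ k s @[k --> U] --> z.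
    by apply: compact_ultra_lim => //; near=> k; exact: (apx_in (apx k)).
  by exists z.
have tau_sg s : A <= s <= B -> tau (sg s) = s.
  move=> sAB; have [_ sgl] := sgP s sAB.
  have l1 : tau (g_ k s) @[k --> U] --> tau (sg s).
    exact: comp_lim tau_cont sgl.
  have l2 : tau (g_ k s) - s @[k --> U] --> (0 : R).
    apply/cvgr0Pnorm_lt => e e0; have /cvgr0Pnorm_lt/(_ _ e0) := eU.
    apply: filterS => k; apply: le_lt_trans.
    exact: le_trans (apx_time (apx k) sAB) (ler_norm _).
  have l3 : tau (g_ k s) - s @[k --> U] --> tau (sg s) - s.
    by apply: cvgB l1 _; exact: cvg_cst.
  by apply/eqP; rewrite -subr_eq0; apply/eqP; exact: cvg_unique l3 l2.
(* If the parameters were in the opposite order along [U], the limit [sg s'] would causally precede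
   [sg s], and monotonicity of [tau] would give s' <= s. *)
have param_lt s s' : A <= s <= B -> A <= s' <= B -> s < s' ->
    \forall k \near U, t_ k s <= t_ k s'.
  move=> sAB s'AB ss'.
  have [//|Ut] := in_ultra_setVsetC [set k | t_ k s <= t_ k s'] UU.
  have [_ sgs] := sgP s sAB; have [_ sgs'] := sgP s' s'AB.
  have /tau_mono : causal d (sg s') (sg s).
    apply: causal_lim sgs' sgs _; apply: filterS Ut => k /negP.
    by rewrite -ltNge => /ltW; exact: (apx_causal (apx k)).
  by rewrite !tau_sg// leNgt ss'.
have sg_lt s s' : A <= s <= B -> A <= s' <= B -> s < s' ->
    strict_causal d (sg s) (sg s').
  move=> sAB s'AB ss'; split; last first.
    by move=> E; move: ss'; rewrite -(tau_sg s sAB) E tau_sg// ltxx.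
  have [_ sgs] := sgP s sAB; have [_ sgs'] := sgP s' s'AB.
  apply: causal_lim sgs sgs' _; apply: filterS (param_lt _ _ sAB s'AB ss') => k.
  exact: (apx_causal (apx k)).
have tau_inj z z' : K z -> K z' -> causal d z z' -> tau z = tau z' -> z = z'.
  move=> Kz Kz' zz' tauE; apply: contrapT => ne.
  by have := tau_strict Kz Kz' (conj zz' ne); rewrite tauE ltxx.
have AAB : A <= A <= B by rewrite lexx ltW.
have BAB : A <= B <= B by rewrite lexx ltW.
exists A, B, sg; split.
- split=> //; last first.
    by move=> s s' As ss' s'B; apply: sg_lt => //; apply/andP; split; lra.
  apply/subspace_continuousP => s0; rewrite /= in_itv/= => s0AB V Vs0.
  have [Ks0 _] := sgP s0 s0AB.
  pose W := within [set` `[A, B]] (nbhs s0).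
  have WAB : W [set s | A <= s <= B].
    by apply: filterS (withinT _ _) => s /=; rewrite in_itv.
  have /compact_near_coveringP cK' : compact (K `&` ~` V^°).
    apply: compact_closedI => //; apply: open_closedC; exact: open_interior.
  (* Continuity at [s0]: for [s] near [s0], [sg s] lies in [K] and misses the compact part of [K]
     outside the interior of [V]. By compactness this is checked near each [z] of that part. *)
  have avoid_near : \forall s \near W, K `&` ~` V^° `<=` (fun z => z <> sg s).
    apply: (cK' _ W (fun s z => z <> sg s)) => z [Kz nVz].
    have zs0 : z <> sg s0 by move=> E; apply: nVz; rewrite E.
    (* At equal time, [z] and [sg s0] are causally unrelated; this persists near [z], while every
       [sg s] is related to [sg s0]. At different times, continuity of [tau] separates [z] from
       [sg s]. *)
    have [tauz|tauz] := eqVneq (tau z) s0.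
      have nc1 : ~ causal d z (sg s0).
        by move=> /tau_inj h; apply: zs0; apply: h; rewrite ?tau_sg.
      have nc2 : ~ causal d (sg s0) z.
        by move=> /tau_inj h; apply/zs0/esym; apply: h; rewrite ?tau_sg.
      exists (~` [set w | causal d w (sg s0)] `&` ~` [set w | causal d (sg s0) w],
        [set s | A <= s <= B]) => /=.
        split=> //; apply: filterI; apply: open_nbhs_nbhs; split=> //.
        - exact/closed_openC/closed_causal_l.
        - exact/closed_openC/closed_causal_r.
      move=> [w s] /= [[n1 n2] sAB] E; subst w.
      have [ss0|s0s|Es] := ltgtP s s0.
      - by apply: n1; have [] := sg_lt s s0 sAB s0AB ss0.
      - by apply: n2; have [] := sg_lt s0 s s0AB sAB s0s.
      - by apply: n1; rewrite Es.
    pose e := `|tau z - s0| / 2.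
    have e0 : 0 < e by rewrite divr_gt0// normr_gt0 subr_eq0.
    have /cvgrPdist_lt/(_ _ e0) near_z := @tau_cont z.
    have near_s : W [set s | A <= s <= B /\ `|s0 - s| < e].
      apply: filterI => //; rewrite /W /within.
      by apply: filterS (nbhsx_ballx s0 e e0) => s se _.
    exists ([set w | `|tau z - tau w| < e], [set s | A <= s <= B /\ `|s0 - s| < e]) => //.
    move=> [w s] /= [ze [sAB se]] E; subst w; move: ze; rewrite tau_sg// => ze.
    by have := ler_distD s (tau z) s0; rewrite (distrC s); move: ze se; rewrite /e; lra.
  apply: filterS2 WAB avoid_near => s sAB avoid; apply: contrapT => nV.
  have [Ks _] := sgP s sAB; apply: (avoid (sg s)) => //; split=> //.
  by move=> /interior_subset.
(* The limit is causally related to [x] and has the same time, so the two coincide; the same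
   argument identifies the other endpoint with [y]. *)
- have [KA sgA] := sgP A AAB; apply/esym/tau_inj => //; last by rewrite tau_sg.
  apply: (causal_lim (fun=> x) _ _ _ _ sgA); first exact: cvg_cst.
  by near=> k; exact: (apx_left (apx k)).
- have [KB sgB] := sgP B BAB; apply: tau_inj => //; last by rewrite tau_sg.
  apply: (causal_lim _ (fun=> y) _ _ sgB); first exact: cvg_cst.
  by near=> k; exact: (apx_right (apx k)).
- move=> hM s s' s'' As ss' s's'' s''B.
  have sAB : A <= s <= B by apply/andP; split; lra.
  have s'AB : A <= s' <= B by apply/andP; split; lra.
  have s''AB : A <= s'' <= B by apply/andP; split; lra.
  have [_ l] := sgP s sAB; have [_ l'] := sgP s' s'AB; have [_ l''] := sgP s'' s''AB.
  have cvg2 (u v : nat -> X) z w : u @ U --> z -> v @ U --> w ->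
      d (u k) (v k) @[k --> U] --> d z w.
    move=> uz vw; apply: (@continuous2_cvg _ _ _ _ _ _ u v d z w _ uz vw).
    exact: (@lms_continuous _ _ _ dX (z, w)).
  have lim1 : d (g_ k s) (g_ k s') + d (g_ k s') (g_ k s'')
      - d (g_ k s) (g_ k s'') @[k --> U] -->
      d (sg s) (sg s') + d (sg s') (sg s'') - d (sg s) (sg s'').
    by apply: cvgB; [apply: cvgD |]; exact: cvg2.
  have lim2 : d (g_ k s) (g_ k s') + d (g_ k s') (g_ k s'')
      - d (g_ k s) (g_ k s'') @[k --> U] --> (0 : R).
    apply/cvgr0Pnorm_lt => e e0; have /cvgr0Pnorm_lt/(_ _ e0) small := eU.
    near=> k; have ek : `|e_ k| < e by near: k.
    apply: le_lt_trans ek; apply: le_trans (ler_norm _).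
    apply: (apx_additive (apx k)) => //; near: k.
    + exact: param_lt.
    + exact: param_lt.
  by apply/eqP; rewrite -subr_eq0; apply/eqP; exact: cvg_unique lim1 lim2.
Unshelve. all: by end_near.
Qed.

End UltraLimit.

(** * Passage to the Gromov-Hausdorff limit *)

Section GHLimit.
Context {R : realType} {X : topologicalType} (d : X -> X -> R) (p : nat -> X).
Context (hX : sequenced_lorentzian_metric_space d p).

(** An increasing exhaustion of the space by the points that a quasi-correspondence of order [k] and
    precision 1/(k+1) must lift. *)
Definition core (k : nat) : set X := Idiam_eps d k.+1%:R^-1 (first_points p k).

Lemma core_near a : \forall k \near \oo, core k a.
Proof.
have [i [j [ia aj]]] := sequenced_bounds hX.2 a.
near=> k; exists (p i), (p j); split.
- by exists i => //=; near: k; exact: nbhs_infty_gt.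
- by exists j => //=; near: k; exact: nbhs_infty_gt.
- by apply: ltW; near: k; exact: invS_near.
- by apply: ltW; near: k; exact: invS_near.
Unshelve. all: by end_near.
Qed.

Lemma core_mono k m : (k <= m)%N -> core k `<=` core m.
Proof.
move=> km a [u [v [[i ik <-] [j jk <-] ia aj]]].
have inv_le : m.+1%:R^-1 <= k.+1%:R^-1 :> R by rewrite lef_pV2 ?posrE// ler_nat.
exists (p i), (p j); split; do ?exact: le_trans inv_le _.
- by exists i => //; exact: leq_trans km.
- by exists j => //; exact: leq_trans km.
Qed.

Lemma core_near_all (q : nat -> X) N :
  \forall k \near \oo, forall j, (j < N)%N -> core k (q j).
Proof.
elim: N => [|N IH]; first by near=> k.
near=> k => j; rewrite ltnS leq_eqVlt => /predU1P[->|jN].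
- by near: k; exact: core_near.
- by apply: (near IH k) => //.
Unshelve. all: by end_near.
Qed.

Lemma curve_connected_limit (X_ : nat -> topologicalType)
    (d_ : forall n : nat, X_ n -> X_ n -> R) (p_ : forall n : nat, nat -> X_ n)
    (M : Prop) :
  (forall n, lorentzian_metric_space (d_ n)) -> GH_converges d_ p_ d p ->
  (forall n, curve_connected (d_ n) M) -> curve_connected d M.
Proof.
move=> dX_ hGH conn x y xy; have [dX p_gen] := hX.
have [i [_ [pix _]]] := sequenced_bounds p_gen x.
have [_ [j [_ ypj]]] := sequenced_bounds p_gen y.
(* [p i'] and [p j'] are the outer points required by [compact_slab]. *)
have [i' [_ [pi' _]]] := sequenced_bounds p_gen (p i).
have [_ [j' [_ pj']]] := sequenced_bounds p_gen (p j).
pose e0 : R := Num.min (d (p i) x) (d y (p j)) / 3.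
have e0_gt0 : 0 < e0 by rewrite divr_gt0// lt_min; apply/andP.
have e0_i : 3 * e0 <= d (p i) x.
  by rewrite /e0 mulrC divfK// ge_min lexx.
have e0_j : 3 * e0 <= d y (p j).
  by rewrite /e0 mulrC divfK// ge_min lexx orbT.
have cK : compact (slab d (p i) (p j) e0) by exact: compact_slab pi' pj'.
have [q sep_q] := exists_separating dX p_gen cK.
have d_ge0 := lms_ge0 dX; have d_cont := lms_continuous dX.
have xy0 : 0 < d x y := xy.
have /choice[tg apx] k : exists tg : (R -> R) * (R -> X),
    approximant d (time d q) x y (slab d (p i) (p j) e0) (core k) k.+1%:R^-1 M
      tg.1 tg.2.
  have eta0 : 0 < k.+1%:R^-1 :> R by rewrite invr_gt0.
  have eta4 : 0 < k.+1%:R^-1 / 4 :> R by rewrite divr_gt0.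
  have eta8 : 0 < k.+1%:R^-1 / 8 :> R by rewrite divr_gt0.
  have [N _ smallN] := exprn_half_small eta4.
  have {}smallN := smallN N (leqnn N).
  (* One [m] serves as order and, through 1/(m+1), as precision. With eta = 1/(k+1), truncation
     takes less than eta/4 and twice the precision less than eta/4, within the allowed eta/2. *)
  have : \forall m \near \oo,
      [/\ (maxn i j < m)%N, (k <= m)%N, m.+1%:R^-1 < Num.min e0 (d x y),
          m.+1%:R^-1 < k.+1%:R^-1 / 8 :> R & forall r, (r < N)%N -> core m (q r)].
    near=> m; split.
    - by near: m; exact: nbhs_infty_gt.
    - by near: m; exact: nbhs_infty_ge.
    - by near: m; apply: invS_near; rewrite lt_min; apply/andP.
    - by near: m; exact: invS_near.
    - by near: m; exact: core_near_all.
  move=> [m _ /(_ m (leqnn m))[ijm km m_lt m_eta m_q]].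
  move: ijm; rewrite gtn_max => /andP[im jm].
  move: m_lt; rewrite lt_min => /andP[/ltW m_e0 /ltW m_xy].
  have m0 : (0 < m)%N by exact: leq_trans im.
  have del0 : 0 < m.+1%:R^-1 :> R by rewrite invr_gt0.
  have [n /(_ n (leqnn n))[S qcS]] := hGH _ _ m0 del0.
  have [del3 del2] : 3 * m.+1%:R^-1 <= k.+1%:R^-1 :> R /\
      2^-1 ^+ N + 2 * m.+1%:R^-1 <= k.+1%:R^-1 / 2 :> R.
    move: (m.+1%:R^-1) (k.+1%:R^-1) (2^-1 ^+ N) del0 eta0 m_eta smallN => *.
    by split; lra.
  have [t [g tgP]] := transport_curve (dX_ n) dX qcS (conn n) xy im jm e0_gt0
    e0_i e0_j m_e0 m_xy (core_mono km) m_q del3 del2.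
  by exists (t, g).
have Kx : slab d (p i) (p j) e0 x.
  have := lms_reverse_triangle dX xy ypj; split; lra.
have Ky : slab d (p i) (p j) e0 y.
  have := lms_reverse_triangle dX pix xy; split; lra.
apply: (limit_curve dX cK (tau := time d q) _ _ _ Kx Ky _ _ _ apx).
- exact: continuous_time.
- by move=> z z'; exact: time_causal.
- by move=> z z' Kz Kz'; exact: time_strict_causal sep_q Kz Kz'.
- exact: chron_strict_causal.
- exact: cvg_harmonic.
- exact: core_near.
Unshelve. all: by end_near.
Qed.

End GHLimit.

Theorem theorem6p17 (R : realType)
    (X_ : nat -> topologicalType) (d_ : forall n : nat, X_ n -> X_ n -> R)
    (p_ : forall n : nat, nat -> X_ n)
    (X : topologicalType) (d : X -> X -> R) (p : nat -> X)
    (hX_ : forall n : nat, sequenced_lorentzian_metric_space (d_ n) (p_ n))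
    (hX : sequenced_lorentzian_metric_space d p)
    (hGH : GH_converges d_ p_ d p) :
  ((forall n : nat, lorentzian_prelength_space (d_ n)) ->
     lorentzian_prelength_space d) /\
  ((forall n : nat, lorentzian_length_space (d_ n)) ->
     lorentzian_length_space d).
Proof.
have dX_ n := (hX_ n).1.
split=> len; split; try exact: hX.1.
- move=> x y xy; have [|a [b [sg [iso sga sgb _]]]] :=
    curve_connected_limit hX (M := False) dX_ hGH _ xy; last first.
    by exists a, b, sg.
  move=> n u v uv; have [a [b [sg [iso sga sgb]]]] := (len n).2 u v uv.
  by exists a, b, sg; split.
- move=> x y xy; have [|a [b [sg [iso sga sgb add_sg]]]] :=
    curve_connected_limit hX (M := True) dX_ hGH _ xy; last first.
    by exists a, b, sg; split => //; split => //; exact: add_sg.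
  move=> n u v uv; have [a [b [sg [[iso add_sg] sga sgb]]]] := (len n).2 u v uv.
  by exists a, b, sg; split.
Qed.
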